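(* Let $P$ be a finite, bounded poset equipped with a special matching $M$, and let $\phi$ be an automorphism of $P$. Then the subposet of $P$ induced by the set of fixed points $\{p\in P\mid \phi(p)=p\}$ has a special matching.
   Context: For a poset $P$, $\lhd$ denotes its covering relation. A matching on $P$ is an involution $M:P\to P$ such that for every $p\in P$ either $M(p)\lhd p$ or $p\lhd M(p)$. A matching $M$ on $P$ is called special if for all $p,q\in P$ with $p\lhd q$, either $M(p)=q$ or $M(p)<M(q)$. A poset is bounded if it has unique maximal and minimal elements. An automorphism of $P$ is an order isomorphism $P\to P$. The subposet induced by a subset $X\subseteq P$ is $X$ with the order restricted from $P$; for a matching on this subposet, the covering relation is that of the subposet itself (not of $P$). *)

(* Defs.v *)
From HB Require Import structures.
From mathcomp Require Import all_boot all_order.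

Set Implicit Arguments.
Unset Strict Implicit.
Unset Printing Implicit Defensive.

Import Order.TTheory.
Local Open Scope order_scope.

Section Posets.
Context {d : Order.disp_t} {P : porderType d}.
Implicit Types (p q x : P) (M phi : P -> P).

Definition covered_by p q : Prop :=
  p < q /\ forall x, ~ (p < x /\ x < q).

Definition matching M : Prop :=
  involutive M /\ forall p, covered_by (M p) p \/ covered_by p (M p).

Definition special_matching M : Prop :=
  matching M /\ forall p q, covered_by p q -> M p = q \/ M p < M q.

Definition maximal p : Prop := forall x, ~ p < x.

Definition minimal p : Prop := forall x, ~ x < p.

(* For a finite poset this amounts to the existence of a greatest and a least
   element; in particular, the empty poset is not bounded. *)
Definition bounded_poset : Prop :=
  (exists! p, maximal p) /\ (exists! p, minimal p).

Definition automorphism phi : Prop :=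
  bijective phi /\ {mono phi : p q / p <= q}.

End Posets.

Arguments bounded_poset {d} P.

Section Subposet.
Context {d : Order.disp_t} {P : finPOrderType d} (X : {set P}).

Record subposet : Type := Subposet { elt : P; _ : elt \in X }.

HB.instance Definition _ := [isSub for elt].
HB.instance Definition _ := [Finite of subposet by <:].
(* The order is the one inherited from P, so that [covered_by] on [subposet]
   is the covering relation of the induced poset and not that of P. *)
HB.instance Definition _ := [SubChoice_isSubPOrder of subposet by <: with d].

Lemma subposet_leE (u v : subposet) : (u <= v) = (elt u <= elt v).
Proof. by rewrite leEsub. Qed.

End Subposet.

Definition fixed_points {d : Order.disp_t} {P : finPOrderType d}
  (phi : P -> P) : {set P} := [set p | phi p == p].

(* Main.v *)
Require Import Defs.
From HB Require Import structures.
From mathcomp Require Import all_boot all_order all_fingroup.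

(** Let [G] be the group generated by the automorphism, and call
    [g \o M \o g^-1], for [g] in [G], the conjugates of [M]. The fixed points
    are studied through the orbits of the group generated by these conjugates,
    as one studies the fixed points of a diagram automorphism of a Coxeter
    group: there, the fixed elements are controlled by parabolic subgroups
    whose only fixed elements are the identity and the longest element.

    The key is the lifting property [lifting]: if [p < M p] and [p <= q], then
    [p <= M q]. A fixed point [p] with [p < M p] lies below its image under
    every conjugate of [M], since each [g] fixes [p]; lifting then shows that
    an element above [p] has its whole orbit above [p] ([fixed_min_le]). In
    particular [p] is the least element of its orbit. Dually, a fixed point
    [p] with [M p < p] is the greatest element of its orbit. Conversely, a
    maximal element of the orbit of a fixed point is pushed down by every
    conjugate, hence is the greatest element, and being unique it is fixed
    because [G] preserves the orbit ([exists_fixed_max]). So the orbit of a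
    fixed point contains exactly two fixed points, its least and its greatest
    element, and [opposite] exchanges them.

    That [opposite] is a special matching follows by comparing orbits: when
    [u <= v] and [u] is least in its orbit, [u] is below the whole orbit of
    [v]; when [v] is greatest in its orbit, [v] is above the whole orbit of
    [u]. The first fact and its dual leave no room for a fixed point strictly
    between [u] and [opposite u]; together they settle the four cases of the
    special condition ([opposite_special]). *)

Set Implicit Arguments.
Unset Strict Implicit.
Unset Printing Implicit Defensive.

Import Order.TTheory.
Local Open Scope order_scope.

(** * The lifting property *)

Section Lifting.
Context {d : Order.disp_t} {P : finPOrderType d}.
Implicit Types (p q x y : P) (M : P -> P).

Lemma card_below_lt p q : p < q -> (#|[set x | (x < p)%O]| < #|[set x | (x < q)%O]|)%N.
Proof.
move=> ltpq; apply/proper_card/properP; split.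
  by apply/subsetP=> x; rewrite !inE => /lt_trans; apply.
by exists p; rewrite !inE ?ltxx.
Qed.

Lemma exists_maximal (A : pred P) p :
  A p -> exists2 m, A m & forall x, A x -> ~ m < x.
Proof.
move=> Ap; case: (arg_maxnP (fun x => #|[set y | (y < x)%O]|) Ap) => m Am maxm.
exists m => // x /maxm le_xm /card_below_lt.
by rewrite ltnNge => /negP[]; exact: le_xm.
Qed.

Lemma exists_covered_by p q : p < q -> exists2 y, p <= y & covered_by y q.
Proof.
move=> ltpq; have [|y /andP[lepy ltyq] maxy] :=
  @exists_maximal (fun x => (p <= x) && (x < q)) p; first by rewrite lexx.
exists y => //; split=> // x [ltyx ltxq].
by apply: (maxy x) => //; rewrite ltxq (le_trans lepy (ltW ltyx)).
Qed.

Lemma matching_lt M p : matching M -> M p < p \/ p < M p.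
Proof. by case=> _ /(_ p)[[]|[]]; [left|right]. Qed.

(** Induction on [q]: choose [y] covered by [q] with [p <= y]. Either [M] swaps
    [y] and [q], so that [M q = y], or [M y < M q] and the induction hypothesis
    for [y] applies. *)
Lemma lifting M p q :
  special_matching M -> p < M p -> p <= q -> p <= M q.
Proof.
move=> [[MK covM] spM] ltpM.
have [n] := ubnP #|[set x | (x < q)%O]|; elim: n q => // n IHn q /ltnSE leqn.
rewrite le_eqVlt => /predU1P[<-|ltpq]; first exact: ltW.
have [y lepy covyq] := exists_covered_by ltpq.
have lepMy : p <= M y.
  by apply: IHn => //; apply: leq_trans leqn; apply: card_below_lt; case: covyq.
have [<-|ltM] := spM _ _ covyq; first by rewrite MK.
exact: le_trans lepMy (ltW ltM).
Qed.

Lemma special_matching_dual M :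
  special_matching M -> special_matching (M : P^d -> P^d).
Proof.
have covE (x y : P) : covered_by (x : P^d) (y : P^d) <-> covered_by y x.
  by split=> -[ltyx novx]; split=> // z [? ?]; apply: (novx z).
move=> [[MK covM] spM]; split; first split=> // p.
  by case: (covM p) => /covE; [right | left].
by move=> p q /covE/spM[<-|]; [left; rewrite MK | right].
Qed.

End Lifting.

(** * Orbits under the conjugates of a special matching *)

Lemma fixP (T : finType) (G : {group {perm T}}) (p : T) :
  reflect {in G, forall g : {perm T}, g p = p} (p \in 'Fix_'P(G)%g).
Proof. exact: (@afixP _ _ _ 'P%act G p). Qed.

Section Orbits.
Context {d : Order.disp_t} {P : finPOrderType d}.
Variables (M : P -> P) (G : {group {perm P}}).
Hypothesis spM : special_matching M.
Hypothesis autG : {in G, forall g : {perm P}, {mono g : x y / x <= y}}.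
Implicit Types (p q x y m : P) (g h : {perm P}).

Let MK : involutive M. Proof. by case: spM => -[]. Qed.

(** [y] is the image of [x] under one of the matchings [g \o M \o g^-1];
    [conj_orbit] is the orbit relation of the group that these generate. *)
Definition conj_step x y := [exists g in G, y == g (M ((g^-1)%g x))].
Definition conj_orbit := connect conj_step.

Lemma conj_stepP x y :
  reflect (exists2 g, g \in G & y = g (M ((g^-1)%g x))) (conj_step x y).
Proof.
by apply: (iffP exists_inP) => -[g Gg /eqP ?]; exists g => //; apply/eqP.
Qed.

Lemma conj_orbit_sym : connect_sym conj_step.
Proof.
suff: symmetric conj_step by exact: sym_connect_sym.
suff sym x y : conj_step x y -> conj_step y x by move=> x y; apply/idP/idP; exact: sym.
by case/conj_stepP=> g Gg ->; apply/conj_stepP; exists g; rewrite // permK MK permKV.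
Qed.

(** Translating by [g] turns the conjugate of [M] by [h] into the conjugate by
    [h * g] (permutations compose from left to right), so that [G] permutes
    the orbits. *)
Lemma conj_orbit_act g x y :
  g \in G -> conj_orbit x y -> conj_orbit (g x) (g y).
Proof.
move=> Gg; case/connectP=> s + ->; elim: s x => [|z s IHs] x /=.
  by rewrite /conj_orbit connect0.
case/andP=> /conj_stepP[h Gh ->] /IHs; apply: connect_trans; apply: connect1.
apply/conj_stepP; exists (h * g)%g; first exact: groupM.
by rewrite invMg !permM permK.
Qed.

(** The hypothesis on [p] says that every conjugate of [M] raises [p]. Each step
    of the orbit is the lifting property transported by [g]. *)
Lemma locally_min_le p x y : {in G, forall g, g p < M (g p)} ->
  p <= x -> conj_orbit x y -> p <= y.
Proof.
move=> minp lepx /connectP[s + ->]; elim: s x lepx => //= z s IHs x lepx.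
case/andP=> /conj_stepP[g Gg ->]; apply: IHs.
have Gg' : (g^-1)%g \in G by rewrite groupV.
rewrite -(autG Gg') permK; apply: lifting => //; first exact: minp.
by rewrite autG.
Qed.

Lemma fixed_min_le p x y : p \in 'Fix_'P(G)%g -> p < M p ->
  p <= x -> conj_orbit x y -> p <= y.
Proof.
by move=> /fixP fixp ltpM; apply: locally_min_le => g /fixp->.
Qed.

End Orbits.

(** * Extremal elements of the orbits of fixed points *)

Section Extremal.
Context {d : Order.disp_t} {P : finPOrderType d}.
Variables (M : P -> P) (G : {group {perm P}}).
Hypothesis spM : special_matching M.
Hypothesis autG : {in G, forall g : {perm P}, {mono g : x y / x <= y}}.
Implicit Types (p q x y m : P) (g h : {perm P}).

Lemma locally_max_ge p x y : {in G, forall g : {perm P}, M (g p) < g p} ->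
  x <= p -> conj_orbit M G x y -> y <= p.
Proof.
move=> maxp lexp xy.
apply: (@locally_min_le _ P^d M G _ _ p x y) => //.
  exact: special_matching_dual.
by move=> g Gg a b; apply: (autG Gg b a).
Qed.

Lemma fixed_max_ge p x y : p \in 'Fix_'P(G)%g -> M p < p ->
  x <= p -> conj_orbit M G x y -> y <= p.
Proof.
by move=> /fixP fixp ltpM; apply: locally_max_ge => g /fixp->.
Qed.

(** Any maximal element [m] of the orbit will do: it is lowered by every conjugate
    of [M], hence is the greatest element of the orbit. Since [p] is fixed, [g m]
    stays in the orbit, so that [g m <= m] for all [g] in [G]. *)
Lemma exists_fixed_max p : p \in 'Fix_'P(G)%g ->
  exists2 m, m \in 'Fix_'P(G)%g /\ M m < m & conj_orbit M G p m.
Proof.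
move=> /fixP fixp.
have [|m pm maxm] := @exists_maximal _ P (conj_orbit M G p) p; first exact: connect0.
have locm g : g \in G -> M (g m) < g m.
  move=> Gg; have [//|lt] := matching_lt (g m) spM.1.
  have Gg' : (g^-1)%g \in G by rewrite groupV.
  (* Otherwise the conjugate by [g^-1] would send [m] strictly above itself. *)
  case: (maxm ((g^-1)%g (M (g m)))).
    apply: connect_trans pm _; apply/connect1/conj_stepP.
    by exists (g^-1)%g; rewrite // invgK.
  by rewrite -(leW_mono (autG Gg)) permKV.
have le_m g : g \in G -> g m <= m.
  move=> Gg; apply: (locally_max_ge locm (lexx m)).
  rewrite /conj_orbit -(same_connect (conj_orbit_sym G spM) pm).
  by have := conj_orbit_act Gg pm; rewrite fixp.
exists m => //; split; last by have := locm _ (group1 G); rewrite perm1.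
apply/fixP=> g Gg; apply/le_anti; rewrite le_m //=.
have Gg' : (g^-1)%g \in G by rewrite groupV.
by rewrite -(autG Gg') permK le_m.
Qed.

End Extremal.

Section ExtremalDual.
Context {d : Order.disp_t} {P : finPOrderType d}.
Variables (M : P -> P) (G : {group {perm P}}).
Hypothesis spM : special_matching M.
Hypothesis autG : {in G, forall g : {perm P}, {mono g : x y / x <= y}}.

Lemma exists_fixed_min p : p \in 'Fix_'P(G)%g ->
  exists2 m, m \in 'Fix_'P(G)%g /\ m < M m & conj_orbit M G p m.
Proof.
move=> fixp.
by apply: (@exists_fixed_max _ P^d M G (special_matching_dual spM)) => // g Gg a b;
   apply: (autG Gg b a).
Qed.

End ExtremalDual.

(** * The special matching on the fixed points *)

Section Opposite.
Context {d : Order.disp_t} {P : finPOrderType d}.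
Variables (M : P -> P) (G : {group {perm P}}).
Hypothesis spM : special_matching M.
Hypothesis autG : {in G, forall g : {perm P}, {mono g : x y / x <= y}}.

Local Notation F := (subposet 'Fix_'P(G)%g).
Implicit Types u v w : F.

Lemma fixed_min_le_sub u v w : elt u < M (elt u) ->
  u <= v -> conj_orbit M G (elt v) (elt w) -> u <= w.
Proof. rewrite !subposet_leE; apply: fixed_min_le => //; exact: valP. Qed.

Lemma fixed_max_ge_sub u v w : M (elt u) < elt u ->
  v <= u -> conj_orbit M G (elt v) (elt w) -> w <= u.
Proof. rewrite !subposet_leE; apply: fixed_max_ge => //; exact: valP. Qed.

Lemma fixed_orbit_min_uniq u v : conj_orbit M G (elt u) (elt v) ->
  elt u < M (elt u) -> elt v < M (elt v) -> u = v.
Proof.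
move=> uv minu minv; apply/le_anti.
rewrite (fixed_min_le_sub minu (lexx u) uv) /=.
by apply: fixed_min_le_sub minv (lexx v) _; rewrite /conj_orbit conj_orbit_sym.
Qed.

Lemma fixed_orbit_max_uniq u v : conj_orbit M G (elt u) (elt v) ->
  M (elt u) < elt u -> M (elt v) < elt v -> u = v.
Proof.
move=> uv maxu maxv; apply/le_anti.
rewrite (fixed_max_ge_sub maxu (lexx u) uv) andbT.
by apply: fixed_max_ge_sub maxv (lexx v) _; rewrite /conj_orbit conj_orbit_sym.
Qed.

(** The other fixed point of the orbit of [u]; the default value [u] is never
    reached, by [oppositeP]. *)
Definition opposite u : F :=
  odflt u [pick v | (v != u) && conj_orbit M G (elt u) (elt v)].

Lemma oppositeP u :
  opposite u != u /\ conj_orbit M G (elt u) (elt (opposite u)).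
Proof.
rewrite /opposite; case: pickP => [v /andP[]//|no_opp].
have [ltM|ltM] := matching_lt (elt u) spM.1.
- have [m [fixm ltMm] um] := exists_fixed_min spM autG (valP u).
  have := no_opp (Subposet fixm); rewrite um andbT => /negbFE/eqP/(congr1 val)/= mu.
  by case/lt_nsym: (ltM); rewrite -mu.
- have [m [fixm ltMm] um] := exists_fixed_max spM autG (valP u).
  have := no_opp (Subposet fixm); rewrite um andbT => /negbFE/eqP/(congr1 val)/= mu.
  by case/lt_nsym: (ltM); rewrite -mu.
Qed.

Lemma opposite_of_min u : elt u < M (elt u) ->
  u < opposite u /\ M (elt (opposite u)) < elt (opposite u).
Proof.
move=> minu; have [neq orb] := oppositeP u; split.
  by rewrite lt_neqAle eq_sym neq (fixed_min_le_sub minu (lexx u) orb).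
have [//|min'] := matching_lt (elt (opposite u)) spM.1.
by rewrite -(fixed_orbit_min_uniq orb minu min') eqxx in neq.
Qed.

Lemma opposite_of_max u : M (elt u) < elt u ->
  opposite u < u /\ elt (opposite u) < M (elt (opposite u)).
Proof.
move=> maxu; have [neq orb] := oppositeP u; split.
  by rewrite lt_neqAle neq (fixed_max_ge_sub maxu (lexx u) orb).
have [max'|//] := matching_lt (elt (opposite u)) spM.1.
by rewrite -(fixed_orbit_max_uniq orb maxu max') eqxx in neq.
Qed.

Lemma oppositeK : involutive opposite.
Proof.
move=> u; have [_ orb] := oppositeP u; have [_ orb'] := oppositeP (opposite u).
have uu := connect_trans orb orb'.
have [max|min] := matching_lt (elt u) spM.1.
  have [_ /opposite_of_min[_ max']] := opposite_of_max max.
  exact/esym/(fixed_orbit_max_uniq uu).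
have [_ /opposite_of_max[_ min']] := opposite_of_min min.
exact/esym/(fixed_orbit_min_uniq uu).
Qed.

(** A fixed [x] strictly between [u] and [opposite u] would be above the whole
    orbit of [u] if [M] lowers it, and below this orbit if [M] raises it. *)
Lemma covered_by_opposite u : elt u < M (elt u) -> covered_by u (opposite u).
Proof.
move=> minu; have [lt_u maxo] := opposite_of_min minu; have [_ orb] := oppositeP u.
split=> // x [ltux ltxo].
have [maxx|minx] := matching_lt (elt x) spM.1.
  by have := fixed_max_ge_sub maxx (ltW ltux) orb; rewrite lt_geF.
have ou : conj_orbit M G (elt (opposite u)) (elt u).
  by rewrite /conj_orbit conj_orbit_sym.
by have := fixed_min_le_sub minx (ltW ltxo) ou; rewrite lt_geF.
Qed.

(** Let [u < v] be a cover among the fixed points. If [M] raises [v], then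
    [opposite v] is greatest in its orbit and above [u], hence above
    [opposite u]; dually if [M] lowers [u]. In the remaining case [M] raises [u]
    and lowers [v], so [v] is above the whole orbit of [u]; then
    [u < opposite u <= v], and the cover forces [opposite u = v]. *)
Lemma opposite_special : special_matching opposite.
Proof.
split; first split=> [|u]; first exact: oppositeK.
  have [maxu|minu] := matching_lt (elt u) spM.1; [left|right].
    have [_ mino] := opposite_of_max maxu.
    by rewrite -{2}(oppositeK u); apply: covered_by_opposite.
  exact: covered_by_opposite.
move=> u v [ltuv nouv].
have [[_ orbu] [_ orbv]] := (oppositeP u, oppositeP v).
have lt_opp : opposite u <= opposite v -> opposite u < opposite v.
  rewrite le_eqVlt => /predU1P[/(can_inj oppositeK) uv|//].
  by rewrite uv ltxx in ltuv.
have [maxu|minu] := matching_lt (elt u) spM.1;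
  have [maxv|minv] := matching_lt (elt v) spM.1.
- right; apply: lt_opp; have [lto mino] := opposite_of_max maxu.
  by apply: fixed_min_le_sub mino _ orbv; apply/ltW/(lt_trans lto).
- right; have [lto _] := opposite_of_max maxu; have [ltv _] := opposite_of_min minv.
  exact: lt_trans lto (lt_trans ltuv ltv).
- left; have [lto _] := opposite_of_min minu.
  have := fixed_max_ge_sub maxv (ltW ltuv) orbu; rewrite le_eqVlt => /predU1P[//|lt].
  by case: (nouv (opposite u)).
- right; apply: lt_opp; have [lto maxo] := opposite_of_min minv.
  by apply: fixed_max_ge_sub maxo _ orbu; apply/ltW/(lt_trans ltuv).
Qed.

End Opposite.

(** * Fixed points of a single automorphism *)

Lemma fixed_points_cycle (d : Order.disp_t) (P : finPOrderType d) (f : {perm P}) :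
  fixed_points f = 'Fix_'P(<[f]>)%g.
Proof.
apply/setP=> p; rewrite inE; apply/eqP/fixP => [fp g|]; last by apply; apply: cycle_id.
case/cycleP=> n ->; elim: n => [|n IHn]; first by rewrite perm1.
by rewrite expgS permM fp.
Qed.

Theorem theorem1p3 (d : Order.disp_t) (P : finPOrderType d) (M phi : P -> P) :
  bounded_poset P ->
  special_matching M ->
  automorphism phi ->
  exists N : subposet (fixed_points phi) -> subposet (fixed_points phi),
    special_matching N.
Proof.
move=> _ spM [/bij_inj inj_phi mono_phi]; set f := perm inj_phi.
have -> : fixed_points phi = 'Fix_'P(<[f]>)%g.
  by rewrite -fixed_points_cycle; apply/setP=> p; rewrite !inE permE.
have autG : {in <[f]>%g, forall g : {perm P}, {mono g : x y / x <= y}}.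
  move=> _ /cycleP[n ->]; elim: n => [|n IHn] x y; first by rewrite !perm1.
  by rewrite expgS !permM IHn !permE mono_phi.
by exists (opposite (G := <[f]>%G) M); apply: opposite_special.
Qed.
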